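(* Assume that the Dynkin diagram of $W$ is connected. Let $P$ and $Q$ be distinct parabolic subgroups of $G$ containing $B$ (where $B$ and $G$ themselves are allowed), and suppose $\{P,Q\}\neq\{G,B\}$. Then the bases $\mathcal{B}_P=\{\sigma_v\sigma_w : v\in W^P,\ w\in W_P\}$ and $\mathcal{B}_Q=\{\sigma_v\sigma_w : v\in W^Q,\ w\in W_Q\}$ of $H^*_T(G/B)$ are distinct.
   Context: $G$ is a complex reductive linear algebraic group, $B$ a fixed Borel subgroup, $T\subseteq B$ the maximal torus, $W$ the Weyl group with simple reflections $s_1,\dots,s_n$ corresponding to the simple roots $\alpha_1,\dots,\alpha_n$, and $\ell$ the length function. For a parabolic subgroup $P\supseteq B$, $W_P\subseteq W$ is the associated subgroup (the Weyl group of $P/B$, generated by the simple reflections it contains), and $W^P$ is the set of minimal-length representatives of the cosets in $W/W_P$. $T$ acts by left multiplication; cohomology has coefficients in $\mathbb{C}$, and $\mathbb{C}[\mathfrak{t}^*]=H^*_T(pt)$ is the polynomial ring (symmetric algebra) on $\mathfrak{t}^*$, containing the roots as degree-one elements. The $T$-fixed points of $G/B$ are identified with $W$. Restriction to fixed points is injective, so $H^*_T(G/B)$ is regarded as a $\mathbb{C}[\mathfrak{t}^*]$-subalgebra of the ring of functions $W\to\mathbb{C}[\mathfrak{t}^*]$ with pointwise operations. It is a free $\mathbb{C}[\mathfrak{t}^*]$-module with basis the equivariant Schubert classes $\{\sigma_w : w\in W\}$, given by Billey's formula: for $u\in W$ with any fixed reduced word $u=s_{b_1}\cdots s_{b_{\ell(u)}}$,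 set $\mathbf{r}(\mathbf{i},u)=s_{b_1}\cdots s_{b_{i-1}}(\alpha_{b_i})$; then $$\sigma_v(u)=\sum \prod_{i=1}^{\ell(v)}\mathbf{r}(\mathbf{j_i},u),$$ where the sum is over all $1\le j_1<\dots<j_{\ell(v)}\le \ell(u)$ such that $s_{b_{j_1}}\cdots s_{b_{j_{\ell(v)}}}$ is a reduced word for $v$. Products are taken in the ring $H^*_T(G/B)$. Each $\mathcal{B}_P$ is a $\mathbb{C}[\mathfrak{t}^*]$-module basis of $H^*_T(G/B)$. Bases are compared as subsets of $H^*_T(G/B)$. *)

(* Defs.v *)
From HB Require Import structures.
From mathcomp Require Import all_boot all_order all_algebra.
From mathcomp Require Import mpoly.
From mathcomp Require Import complex.
From mathcomp Require Import boolp classical_sets reals.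

Set Implicit Arguments.
Unset Strict Implicit.
Unset Printing Implicit Defensive.

Import Order.TTheory GRing.Theory Num.Theory.
Local Open Scope ring_scope.

(* A connected complex reductive group together with T and B is encoded by its
   based root datum.  The character lattice X(T) is Z^r (columns), the
   cocharacter lattice is Z^r (rows), and the perfect pairing between them is
   the matrix product.  Here r = dim T, while n, the number of simple roots, is
   the semisimple rank; r > n is allowed. *)
Definition pairing r (y : 'rV[int]_r) (x : 'cV[int]_r) : int :=
  (y *m x) ord0 ord0.

(* Acting on columns on the left this is x |-> x - <x, c> a, acting on rows on
   the right it is y |-> y - <a, y> c; matrix products are composites of maps
   in the usual order. *)
Definition reflection r (a : 'cV[int]_r) (c : 'rV[int]_r) : 'M[int]_r :=
  1%:M - a *m c.

(* The value of [coroot] outside [roots] is irrelevant. *)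
Record based_root_datum (r n : nat) : Type := BasedRootDatum {
  roots : seq 'cV[int]_r;
  coroot : 'cV[int]_r -> 'rV[int]_r;
  simple : 'I_n -> 'cV[int]_r;
  coroot_inj : {in roots &, injective coroot};
  coroot_root : forall a, a \in roots -> pairing (coroot a) a = 2;
  reflection_root : forall a b, a \in roots -> b \in roots ->
    reflection a (coroot a) *m b \in roots;
  reflection_coroot : forall a b, a \in roots -> b \in roots ->
    coroot b *m reflection a (coroot a) \in [seq coroot x | x <- roots];
  roots_reduced : forall (a b : 'cV[int]_r) (k l : int),
    a \in roots -> b \in roots -> l != 0 -> l *: b = k *: a ->
    b = a \/ b = - a;
  simple_root : forall i, simple i \in roots;
  simple_free : forall c : 'I_n -> int,
    \sum_i c i *: simple i = 0 -> forall i, c i = 0;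
  simple_span : forall a, a \in roots -> exists c : 'I_n -> nat,
    a = \sum_i (c i)%:Z *: simple i \/ a = - \sum_i (c i)%:Z *: simple i
}.

Section WeylGroup.

Variables (r n : nat) (D : based_root_datum r n).

Definition simple_reflection (i : 'I_n) : 'M[int]_r :=
  reflection (simple D i) (coroot D (simple D i)).

Definition word_prod (b : seq 'I_n) : 'M[int]_r :=
  \prod_(i <- b) simple_reflection i.

Definition weyl : set 'M[int]_r := [set w | exists b, word_prod b = w]%classic.

Definition reduced_word (b : seq 'I_n) (w : 'M[int]_r) : Prop :=
  word_prod b = w /\ forall b', word_prod b' = w -> (size b <= size b')%N.

(* The length of w; 0 by convention if w is not in the Weyl group. *)
Definition length (w : 'M[int]_r) : nat :=
  xget 0%N [set k | exists2 b, reduced_word b w & size b = k]%classic.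

Definition dynkin_edge : rel 'I_n :=
  fun i j => (i != j) && (pairing (coroot D (simple D j)) (simple D i) != 0).

Definition dynkin_connected : Prop := forall i j, connect dynkin_edge i j.

(* A parabolic subgroup P containing B is encoded by the set J of those i such
   that P contains s_i: J = set0 is B, J = setT is G. *)

(* W_P *)
Definition weyl_parabolic (J : {set 'I_n}) : set 'M[int]_r :=
  [set w | exists2 b, {subset b <= J} & word_prod b = w]%classic.

(* W^P: the v of minimal length in v W_P. *)
Definition min_coset_reps (J : {set 'I_n}) : set 'M[int]_r :=
  [set v | weyl v /\
     forall x, weyl_parabolic J x -> (length v <= length (v *m x))%N]%classic.

End WeylGroup.

Section Schubert.

Variables (K : comNzRingType) (r n : nat) (D : based_root_datum r n).

(* X(T) -> t^* = X(T) (x) K, the latter being the degree-one part of the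
   polynomial ring K[t^*]. *)
Definition linear_form (x : 'cV[int]_r) : {mpoly K[r]} :=
  \sum_k (x k ord0)%:~R *: 'X_k.

(* s_{b_1} ... s_{b_{i-1}} (alpha_{b_i}), with positions counted from 0. *)
Definition word_root (b : seq 'I_n) (i : 'I_(size b)) : 'cV[int]_r :=
  word_prod D (take i b) *m simple D (tnth (in_tuple b) i).

(* [enum J] lists the positions in J in increasing order. *)
Definition subword (b : seq 'I_n) (J : {set 'I_(size b)}) : seq 'I_n :=
  [seq tnth (in_tuple b) j | j <- enum J].

(* Billey's sum for v, computed in the word b.  The cardinal of J is the
   length of v, as the subword is reduced. *)
Definition billey (b : seq 'I_n) (v : 'M[int]_r) : {mpoly K[r]} :=
  \sum_(J : {set 'I_(size b)} | `[< reduced_word D (subword J) v >])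
    \prod_(j in J) linear_form (word_root j).

(* The class sigma_v as a function on the fixed points; [rw u] is the reduced
   word of u which has been fixed to evaluate it at u. *)
Definition schubert (rw : weyl D -> seq 'I_n) (v : 'M[int]_r) :
  weyl D -> {mpoly K[r]} := fun u => billey (rw u) v.

(* The set B_P of the products sigma_v sigma_w, with v in W^P and w in W_P. *)
Definition product_basis (rw : weyl D -> seq 'I_n) (J : {set 'I_n}) :
  set (weyl D -> {mpoly K[r]}) :=
  [set schubert rw v \* schubert rw w |
     v in min_coset_reps D J & w in weyl_parabolic D J]%classic.

End Schubert.

Arguments product_basis K {r n} D rw J.

(* Main.v *)
Require Import Defs.
From mathcomp Require Import all_boot all_order all_algebra.
From mathcomp Require Import mpoly.
From mathcomp Require Import complex.
From mathcomp Require Import boolp classical_sets reals.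
From mathcomp Require Import ring zify.

(* The degree-two part of B_P already determines P, up to exchanging G and B.
   If i and j are adjacent in the Dynkin diagram then sigma_{s_i s_j} belongs to
   B_P unless i is not in P and j is; in that case the only product of the
   right support is sigma_i sigma_j = sigma_{s_i s_j} + sigma_{s_j s_i}.  Hence
   B_P determines the oriented edges which enter P, and as the diagram is
   connected these determine P as soon as there is one. *)

Set Implicit Arguments.
Unset Strict Implicit.
Unset Printing Implicit Defensive.

Import Order.TTheory GRing.Theory Num.Theory.
Local Open Scope ring_scope.

(** * Simple roots, their coefficients and the Dynkin diagram *)

Section WeylWords.

Variables (r n : nat) (D : based_root_datum r n).

Local Notation simple := (simple D).
Local Notation s := (simple_reflection D).
Local Notation cartan i j := (pairing (coroot D (simple j)) (simple i)).

Lemma reflectionE (a : 'cV[int]_r) c v :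
  reflection a c *m v = v - pairing c v *: a.
Proof.
rewrite /reflection mulmxBl mul1mx -mulmxA.
by rewrite [c *m v]mx11_scalar mul_mx_scalar.
Qed.

Lemma cartan_diag i : cartan i i = 2.
Proof. exact/coroot_root/simple_root. Qed.

Lemma simple_reflection_self i : s i *m simple i = - simple i.
Proof.
by rewrite reflectionE cartan_diag; apply/matrixP=> k l; rewrite !mxE; ring.
Qed.

Lemma simple_reflectionK i : s i *m s i = 1%:M.
Proof.
rewrite {2}/simple_reflection /reflection mulmxBr mulmx1 mulmxA.
rewrite simple_reflection_self mulNmx opprK.
by rewrite /simple_reflection /reflection subrK.
Qed.

(** Packing the coefficients into a finite function lets identities between vectors be compared one
    simple root at a time, through [simple_comb_inj]. *)
Definition simple_comb (c : {ffun 'I_n -> int}) : 'cV[int]_r :=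
  \sum_i c i *: simple i.

Lemma simple_combD c1 c2 :
  simple_comb (c1 + c2) = simple_comb c1 + simple_comb c2.
Proof.
by rewrite -big_split; apply: eq_bigr => i _; rewrite ffunE scalerDl.
Qed.

Lemma simple_combN c : simple_comb (- c) = - simple_comb c.
Proof. by rewrite -sumrN; apply: eq_bigr => i _; rewrite ffunE scaleNr. Qed.

Lemma simple_comb_inj : injective simple_comb.
Proof.
move=> c1 c2 /eqP; rewrite -subr_eq0 -simple_combN -simple_combD.
move=> /eqP/simple_free c0.
by apply/ffunP => i; have := c0 i; rewrite !ffunE => /subr0_eq.
Qed.

Lemma simple_comb1 i k : k *: simple i = simple_comb [ffun l => k *+ (l == i)].
Proof.
rewrite /simple_comb (bigD1 i) //= big1 ?addr0 => [|l /negbTE li].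
  by rewrite ffunE eqxx.
by rewrite ffunE li scale0r.
Qed.

(** The coefficients of a root in the simple roots are unique, and [simple_span] gives them a common
    sign. *)
Lemma root_two_signs i j p q : i != j ->
  p *: simple i + q *: simple j \in Defs.roots D -> 0 <= p * q.
Proof.
move=> ij /simple_span[c]; rewrite !simple_comb1 -simple_combD.
have -> : \sum_i (c i)%:Z *: simple i = simple_comb [ffun k => (c k)%:Z].
  by apply: eq_bigr => k _; rewrite ffunE.
rewrite -simple_combN => -[] /simple_comb_inj/ffunP eqc;
  have := eqc i; have := eqc j;
  rewrite !ffunE !eqxx (negbTE ij) eq_sym (negbTE ij).
  by rewrite !mulr1n addr0 add0r => -> ->; rewrite mulr_ge0.
by rewrite !mulr1n addr0 add0r => -> ->; rewrite mulrNN mulr_ge0.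
Qed.

Lemma dynkin_edge_sym : ssrbool.symmetric (dynkin_edge D).
Proof.
suff edgeC i j : dynkin_edge D i j -> dynkin_edge D j i.
  by move=> i j; apply/idP/idP; apply: edgeC.
rewrite /dynkin_edge eq_sym => /andP[ji cij]; rewrite ji.
apply: contra cij => /eqP cji.
have refl_root k a : a \in Defs.roots D -> s k *m a \in Defs.roots D.
  by move=> aD; apply: reflection_root => //; apply: simple_root.
(* As s_i fixes alpha_j, both alpha_i - c alpha_j and - alpha_i - c alpha_j are
   roots, where c = cartan i j. *)
have sj_root := refl_root j _ (simple_root D i).
have := sj_root; have := refl_root i _ sj_root.
rewrite [s j *m _]reflectionE mulmxBr -scalemxAr simple_reflection_self.
rewrite [s i *m _]reflectionE cji scale0r subr0.
rewrite -scaleNr -scaleN1r => /root_two_signs; rewrite eq_sym => /(_ ji) neg.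
rewrite -[X in X + _]scale1r => /root_two_signs; rewrite eq_sym => /(_ ji) pos.
by lia.
Qed.

(** * The action of words on vectors *)

Lemma word_prod_nil : word_prod D [::] = 1%:M.
Proof. by rewrite /word_prod big_nil. Qed.

Lemma word_prod_cons i b : word_prod D (i :: b) = s i *m word_prod D b.
Proof. by rewrite /word_prod big_cons. Qed.

Lemma word_prod_cat b1 b2 :
  word_prod D (b1 ++ b2) = word_prod D b1 *m word_prod D b2.
Proof. by rewrite /word_prod big_cat. Qed.

Lemma word_prod1 i : word_prod D [:: i] = s i.
Proof. by rewrite word_prod_cons word_prod_nil mulmx1. Qed.

Lemma word_prod_revK b : word_prod D b *m word_prod D (rev b) = 1%:M.
Proof.
elim: b => [|i b IH]; first by rewrite word_prod_nil mulmx1.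
rewrite rev_cons -cats1 word_prod_cons word_prod_cat word_prod1 mulmxA.
by rewrite -[_ *m _ *m word_prod D (rev b)]mulmxA IH mulmx1 simple_reflectionK.
Qed.

(** Each letter of the word changes a vector by a multiple of its own simple root. *)
Lemma word_prod_comb b v : exists2 c : {ffun 'I_n -> int},
  word_prod D b *m v = v + simple_comb c & forall i, i \notin b -> c i = 0.
Proof.
elim: b => [|i b [c cE c0]].
  exists 0 => [|i _]; rewrite ?ffunE // word_prod_nil mul1mx.
  rewrite /simple_comb big1 ?addr0 //.
  by move=> k _; rewrite ffunE scale0r.
pose k := pairing (coroot D (simple i)) (v + simple_comb c).
exists (c + [ffun l => - k *+ (l == i)]).
  rewrite word_prod_cons -mulmxA cE reflectionE.
  by rewrite simple_combD -simple_comb1 scaleNr addrA.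
by move=> l; rewrite inE !ffunE => /norP[/negbTE-> /c0->]; rewrite addr0.
Qed.

(* Modulo the simple roots other than alpha_i, the first word acts on a suitable
   vector congruent to alpha_i as -1, while a word without i acts as 1. *)
Lemma letter_once_mem b1 i b2 b : i \notin b1 -> i \notin b2 ->
  word_prod D (b1 ++ i :: b2) = word_prod D b -> i \in b.
Proof.
move=> ib1 ib2 eb; apply: contraT => ib.
pose v := word_prod D (rev b2) *m simple i.
have [c2 c2E c2i] := word_prod_comb (rev b2) (simple i).
have [c cE ci] := word_prod_comb b v.
have [c1 c1E c1i] := word_prod_comb b1 (- simple i).
have := congr1 (mulmx^~ v) eb; rewrite /= cE word_prod_cat word_prod_cons.
rewrite /v -!mulmxA (mulmxA (word_prod D b2)) word_prod_revK mul1mx.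
rewrite simple_reflection_self c1E c2E -[simple i]scale1r simple_comb1.
rewrite -simple_combN -!simple_combD => /simple_comb_inj/ffunP/(_ i).
by rewrite !ffunE eqxx c1i // ci // c2i ?mem_rev.
Qed.

(** * Lengths and unique reduced words *)

Lemma length_reduced b w : reduced_word D b w -> length D w = size b.
Proof.
move=> [bw bmin]; rewrite /length.
case: xgetP => [k -> [b' [b'w b'min] <-]|/(_ (size b))].
  by apply/eqP; rewrite eqn_leq bmin // b'min.
by case; exists b.
Qed.

Lemma reduced_word_exists w : weyl D w -> exists b, reduced_word D b w.
Proof.
move=> [b0 b0w].
have ex : exists k, `[< exists2 b, word_prod D b = w & size b = k >].
  by exists (size b0); apply/asboolP; exists b0.
case: (ex_minnP ex) => k /asboolP[b bw <-] kmin; exists b; split=> // b' b'w.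
by apply: kmin; apply/asboolP; exists b'.
Qed.

(** A single condition for reducedness of [b] and uniqueness as a reduced word: only subwords equal
    to [b] then contribute to Billey's sum for its product. *)
Definition unique_reduced b :=
  forall b', word_prod D b' = word_prod D b -> (size b' <= size b)%N -> b' = b.

Lemma unique_reduced_reduced b :
  unique_reduced b -> reduced_word D b (word_prod D b).
Proof.
move=> ub; split=> // b' e; rewrite leqNgt; apply/negP => lt.
by have := lt; rewrite (ub _ e (ltnW lt)) ltnn.
Qed.

Lemma reduced_unique b b' : unique_reduced b ->
  reduced_word D b' (word_prod D b) -> b' = b.
Proof. by move=> ub [e m]; apply: ub => //; apply: m. Qed.

Lemma unique_reduced_nil : unique_reduced [::].
Proof. by case. Qed.

Lemma unique_reduced1 i : unique_reduced [:: i].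
Proof.
move=> b' e; have : i \in b' by apply: (@letter_once_mem [::] i [::] b').
by case: b' e => [|k [|]] //; rewrite inE => _ /eqP->.
Qed.

(** Applied to alpha_j, the two products have opposite alpha_i-coefficients, plus and minus
    [cartan j i], which is nonzero. *)
Lemma not_commuting i j : dynkin_edge D i j ->
  word_prod D [:: i; j] <> word_prod D [:: j; i].
Proof.
move=> eij; have := eij; rewrite dynkin_edge_sym => eji.
have [/andP[ij _] /andP[_ cji]] := (eij, eji).
move=> /(congr1 (mulmx^~ (simple j))).
rewrite /= !word_prod_cons word_prod_nil !mulmx1.
rewrite -!mulmxA simple_reflection_self mulmxN ![s i *m _]reflectionE.
rewrite mulmxBr -scalemxAr simple_reflection_self [s j *m _]reflectionE.
move: (cartan j i) cji (cartan i j) => m m_neq0 m'.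
rewrite -[simple j]scale1r -[simple i]scale1r !scalerBr !scalerA !simple_comb1.
rewrite -!(simple_combN, simple_combD) => /simple_comb_inj/ffunP/(_ i).
by rewrite !ffunE eqxx (negbTE ij) !mulr0n !mulr1n; lia.
Qed.

(** Both letters must occur by [letter_once_mem], which leaves only the two orders, and these have
    different products. *)
Lemma unique_reduced2 i j : dynkin_edge D i j -> unique_reduced [:: i; j].
Proof.
move=> eij b' e; have /andP[ij _] := eij.
have ib : i \in b' by apply: (@letter_once_mem [::] i [:: j] b'); rewrite ?inE.
have jb : j \in b'.
  by apply: (@letter_once_mem [:: i] j [::] b'); rewrite ?inE // eq_sym.
case: b' e ib jb => [|k [|l [|]]] //= e; rewrite !inE.
  by move=> /eqP ik; rewrite -ik eq_sym (negbTE ij).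
case: (eqVneq i k) => [<- _|_ /eqP il].
  by rewrite eq_sym (negbTE ij) => /eqP->.
move: e; rewrite -il [j == i]eq_sym (negbTE ij) orbF => e /eqP jk.
by case: (not_commuting eij); rewrite -e -jk.
Qed.

(** * Minimal coset representatives and parabolic subgroups *)

Lemma mem_min_coset_reps (P : {set 'I_n}) b : unique_reduced b ->
  (forall c b', {subset c <= P} -> (size b' < size b)%N ->
     word_prod D (b ++ c) <> word_prod D b') ->
  min_coset_reps D P (word_prod D b).
Proof.
move=> ub short; split; first by exists b.
move=> x [c cP <-]; rewrite -word_prod_cat.
rewrite (length_reduced (unique_reduced_reduced ub)).
have [|b' b'r] := @reduced_word_exists (word_prod D (b ++ c)).
  by exists (b ++ c).
rewrite (length_reduced b'r) leqNgt; apply/negP => lt.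
by apply: (short c b' cP lt); rewrite b'r.1.
Qed.

Lemma min_coset_reps_nil (P : {set 'I_n}) :
  min_coset_reps D P (word_prod D [::]).
Proof. exact: mem_min_coset_reps unique_reduced_nil _. Qed.

Lemma min_coset_reps2 (P : {set 'I_n}) i j : dynkin_edge D i j -> j \notin P ->
  min_coset_reps D P (word_prod D [:: i; j]).
Proof.
move=> eij jP.
apply: mem_min_coset_reps (unique_reduced2 eij) _ => c b' cP b'2 e.
have := eij; rewrite dynkin_edge_sym => eji.
have [/andP[ij cij] /andP[_ cji]] := (eij, eji).
have jc : j \notin c by apply: contra jP; apply: cP.
have jb' : j \in b'.
  by apply: (@letter_once_mem [:: i] j c b') => //; rewrite inE eq_sym.
case: b' b'2 jb' e => [|k [|]] // _; rewrite inE => /eqP <-.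
(* A shorter word can only be s_j; then s_j s_i s_j is in W_P, which the
   alpha_j-coefficient of s_j s_i s_j (alpha_j) excludes. *)
move/(congr1 (mulmx (word_prod D (rev [:: i; j])))).
rewrite word_prod_cat mulmxA -{2}[[:: i; j]]revK word_prod_revK mul1mx.
have [d dE dj] := word_prod_comb c (simple j).
move/(congr1 (mulmx^~ (simple j))).
rewrite /= dE !word_prod_cons word_prod_nil !mulmx1.
rewrite -!mulmxA simple_reflection_self !mulmxN [s i *m _]reflectionE.
rewrite mulmxBr -scalemxAr simple_reflection_self [s j *m _]reflectionE.
(* The coefficient is 1 for the word [c], whose letters avoid j, and 1 - m m' for s_j s_i s_j. *)
have := mulf_neq0 cij cji; move: (cartan i j) (cartan j i) => m m' mm'_neq0.
rewrite -[simple j]scale1r -[simple i]scale1r !scalerBr !scalerA !simple_comb1.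
rewrite -!(simple_combN, simple_combD) => /simple_comb_inj/ffunP/(_ j).
by rewrite !ffunE eqxx eq_sym (negbTE ij) dj // !mulr0n !mulr1n; lia.
Qed.

(** Multiplying by s_i on the right stays in the coset and deletes the last letter. *)
Lemma min_coset_reps_descent (P : {set 'I_n}) b i :
  i \in P -> unique_reduced (rcons b i) ->
  ~ min_coset_reps D P (word_prod D (rcons b i)).
Proof.
move=> iP ub [_ /(_ (s i))].
rewrite (length_reduced (unique_reduced_reduced ub)).
rewrite -cats1 word_prod_cat word_prod1 -mulmxA simple_reflectionK mulmx1.
have [|b' b'r] := @reduced_word_exists (word_prod D b); first by exists b.
rewrite (length_reduced b'r) size_cat addn1 leqNgt ltnS b'r.2 // => h.
have /h : weyl_parabolic D P (s i).
  by exists [:: i]; [move=> k; rewrite inE => /eqP-> | rewrite word_prod1].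
by [].
Qed.

Lemma not_weyl_parabolic (P : {set 'I_n}) b1 i b2 :
  i \notin b1 -> i \notin b2 -> i \notin P ->
  ~ weyl_parabolic D P (word_prod D (b1 ++ i :: b2)).
Proof.
move=> ib1 ib2 /negP iP [b bP]; move/esym/(letter_once_mem ib1 ib2)/bP.
exact: iP.
Qed.

End WeylWords.

Lemma subseq2_mem (T : eqType) (c : seq T) i j :
  subseq c [:: i; j] -> c \in [:: [::]; [:: i]; [:: j]; [:: i; j]].
Proof.
by case: c => [|k [|l [|m c]]] //=; do !(case: ifP => [/eqP->|_] //=);
  rewrite ?inE ?eqxx ?orbT.
Qed.

(** * Values of Billey's formula *)

Section Billey.

Variables (K : numDomainType) (r n : nat) (D : based_root_datum r n).

(** The integers embed in [K], so the coefficient of each variable recovers a coordinate of [x]. *)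
Lemma linear_form_eq0 x : (linear_form K x == 0 :> {mpoly K[r]}) = (x == 0).
Proof.
apply/eqP/eqP => [/mpolyP x0|->]; last first.
  by rewrite /linear_form big1 // => k _; rewrite mxE scale0r.
apply/matrixP => i j; rewrite ord1 mxE.
have := x0 U_(i)%MM; rewrite mcoeff0 /linear_form raddf_sum /= (bigD1 i) //=.
rewrite big1 => [|k ki]; last first.
  by rewrite mcoeffZ mcoeffX eq_mnm1 (negbTE ki) mulr0.
rewrite mcoeffZ mcoeffX eqxx mulr1 addr0 => /eqP; rewrite intr_eq0 => /eqP //.
Qed.

(** The prefix acts invertibly, and a zero simple root could not pair to 2 with its coroot. *)
Lemma word_root_neq0 (b : seq 'I_n) (i : 'I_(size b)) : word_root D i != 0.
Proof.
apply/eqP => /(congr1 (mulmx (word_prod D (rev (take i b))))).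
rewrite /word_root mulmx0 mulmxA -{2}[take i b]revK word_prod_revK mul1mx => e.
have := cartan_diag D (tnth (in_tuple b) i).
by rewrite e /pairing mulmx0 mxE.
Qed.

Lemma subword_subseq (b : seq 'I_n) (J : {set 'I_(size b)}) :
  subseq (subword J) b.
Proof.
rewrite -[X in subseq _ X](map_tnth_enum (in_tuple b)); apply: map_subseq.
rewrite enumT; exact: filter_subseq.
Qed.

Lemma mem_subword (b : seq 'I_n) (J : {set 'I_(size b)}) k :
  uniq b -> (tnth (in_tuple b) k \in subword J) = (k \in J).
Proof. by move=> /(tuple_uniqP (in_tuple b)) bI; rewrite mem_map ?mem_enum. Qed.

Lemma subword_mem (b c : seq 'I_n) : uniq b -> subseq c b ->
  subword [set k | tnth (in_tuple b) k \in c] = c.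
Proof.
move=> bu /(subseq_uniqP bu) cE; rewrite [RHS]cE.
rewrite -[X in filter _ X](map_tnth_enum (in_tuple b)) filter_map /subword.
congr map; rewrite enumT [in LHS]/enum_mem; apply: eq_filter => k /=.
by rewrite inE.
Qed.

Lemma billey_unique (b : seq 'I_n) v (J : {set 'I_(size b)}) :
  (forall J', reduced_word D (subword J') v <-> J' = J) ->
  billey K D b v = \prod_(j in J) linear_form K (word_root D j).
Proof.
by move=> JP; rewrite /billey (big_pred1 J) // => J'; apply/asboolP/eqP => /JP.
Qed.

Lemma billey1 b : billey K D b (word_prod D [::]) = 1.
Proof.
rewrite (@billey_unique _ _ finset.set0) ?big_set0 // => J; split=> [|->].
  move=> /(reduced_unique (@unique_reduced_nil _ _ D))/(congr1 size)/eqP.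
  by rewrite size_map -cardE cards_eq0 => /eqP.
rewrite /subword enum_set0.
exact/unique_reduced_reduced/unique_reduced_nil.
Qed.

(** As [b] has no repeated letter, exactly one set of positions gives the subword [c]; its term is a
    product of nonzero linear forms in an integral domain. *)
Lemma billey_neq0 b c : uniq b -> subseq c b -> unique_reduced D c ->
  billey K D b (word_prod D c) != 0.
Proof.
move=> bu cb cu.
rewrite (@billey_unique _ _ [set k | tnth (in_tuple b) k \in c]%SET).
  by apply/prodf_neq0 => k _; rewrite linear_form_eq0 word_root_neq0.
move=> J; split=> [/(reduced_unique cu) Jc|->].
  by apply/setP => k; rewrite inE -Jc mem_subword.
by rewrite subword_mem //; apply: unique_reduced_reduced.
Qed.

(** For a reduced word [b] of u, this is the vanishing of sigma_v(u) unless v <= u in the Bruhat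
    order. *)
Lemma billey_neq0_subseq b v : billey K D b v != 0 ->
  exists2 c, reduced_word D c v & subseq c b.
Proof.
move=> /eqP nz; apply: contrapT => h; apply: nz.
rewrite /billey big_pred0 // => J; apply/asboolP => Jv; apply: h.
by exists (subword J); rewrite ?subword_subseq.
Qed.

(** * Schubert classes and their membership in B_P *)

Variables (rw : weyl D -> seq 'I_n).
Hypothesis rw_reduced : forall u : weyl D, reduced_word D (rw u) (val u).

(** The choice [rw] is arbitrary, but at the product of [b] it can only pick [b]. *)
Lemma schubert_word b : unique_reduced D b ->
  exists u, forall v, schubert K rw v u = billey K D b v.
Proof.
move=> bu; have bW : weyl D (word_prod D b) by exists b.
exists (SigSub (mem_set bW)) => v; rewrite /schubert.
by congr billey; apply: (reduced_unique bu); apply: rw_reduced.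
Qed.

Lemma schubert1 u : schubert K rw (word_prod D [::]) u = 1.
Proof. exact: billey1. Qed.

(* If i is not in P while j is, any product of this form which is nonzero at
   s_i s_j only involves 1, s_i, s_j, so that it is also nonzero at s_j s_i,
   where the class of s_i s_j vanishes. *)
Lemma schubert2_product_basis (P : {set 'I_n}) i j : dynkin_edge D i j ->
  product_basis K D rw P (schubert K rw (word_prod D [:: i; j])) <->
  ~~ ((i \notin P) && (j \in P)).
Proof.
move=> eij; have /andP[ij _] := eij.
have ub := unique_reduced2 eij; have nil_u := @unique_reduced_nil _ _ D.
have one_u := @unique_reduced1 _ _ D.
have bu : uniq [:: i; j] by rewrite /= inE ij.
split; last first.
  rewrite negb_and negbK => /orP iPjP.
  have [jP|jP] := boolP (j \in P); last first.
    exists (word_prod D [:: i; j]); first exact: min_coset_reps2.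
    exists (word_prod D [::]); first by exists [::].
    by apply/funext => u; rewrite /= schubert1 mulr1.
  have iP : i \in P by case: iPjP => //; rewrite jP.
  exists (word_prod D [::]); first exact: min_coset_reps_nil.
  exists (word_prod D [:: i; j]).
    by exists [:: i; j] => // k; rewrite !inE => /orP[]/eqP->.
  by apply/funext => u; rewrite /= schubert1 mul1r.
move=> [v vP [w wP e]]; apply/negP => /andP[iP jP].
have [u uE] := schubert_word ub.
have := billey_neq0 bu (subseq_refl _) ub.
rewrite -uE -e /= !uE mulf_eq0 negb_or.
move=> /andP[/billey_neq0_subseq[c cv cb] /billey_neq0_subseq[d dw db]].
(* The other two subwords end in j, which lies in [P], so their products are not minimal in their
   cosets. *)
have {vP} c_i : c \in [:: [::]; [:: i]].
  move: vP; rewrite -cv.1 => vP; move: (subseq2_mem cb) vP; rewrite !inE.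
  case/or4P => /eqP->; rewrite ?eqxx ?orbT // => vP; exfalso.
    exact: (min_coset_reps_descent (b := [::]) jP (one_u j)).
  exact: (min_coset_reps_descent (b := [:: i]) jP ub).
(* The other two subwords contain i, which is not in [P]. *)
have {wP} d_j : d \in [:: [::]; [:: j]].
  move: wP; rewrite -dw.1 => wP; move: (subseq2_mem db) wP; rewrite !inE.
  case/or4P => /eqP->; rewrite ?eqxx ?orbT // => wP; exfalso.
    exact: (not_weyl_parabolic (b1 := [::]) (b2 := [::]) isT isT iP wP).
  apply: (not_weyl_parabolic (b1 := [::]) (b2 := [:: j]) isT _ iP wP).
  by rewrite inE.
have eji : dynkin_edge D j i by rewrite dynkin_edge_sym.
have [u' u'E] := schubert_word (unique_reduced2 eji).
have : schubert K rw (word_prod D [:: i; j]) u' == 0.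
  rewrite u'E; apply: contraT => /billey_neq0_subseq[c' /(reduced_unique ub)->].
  by rewrite /= (negbTE ij) eqxx.
(* Both [c] and [d] are also subwords of [[:: j; i]], so neither factor vanishes at s_j s_i. *)
have bu' : uniq [:: j; i] by rewrite /= inE eq_sym ij.
rewrite -e /= !u'E mulf_eq0 -cv.1 -dw.1.
case/orP; apply/negP; apply: billey_neq0 => //.
- by move: c_i; rewrite !inE => /orP[]/eqP-> /=; rewrite ?(negbTE ij) ?eqxx.
- by move: c_i; rewrite !inE => /orP[]/eqP->.
- by move: d_j; rewrite !inE => /orP[]/eqP-> /=; rewrite ?eqxx.
- by move: d_j; rewrite !inE => /orP[]/eqP->.
Qed.

End Billey.

(** * Recovering P from the edges which enter it *)

Theorem theorem4p3 (R : realType) (r n : nat) (D : based_root_datum r n)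
    (rw : weyl D -> seq 'I_n)
    (rw_reduced : forall u : weyl D, reduced_word D (rw u) (val u))
    (D_connected : dynkin_connected D)
    (P Q : {set 'I_n})
    (P_neq_Q : P <> Q)
    (PQ_neq_GB : ([set P; Q] <> [set finset.setT; finset.set0])%SET) :
  product_basis (complex R) D rw P <> product_basis (complex R) D rw Q.
Proof.
move=> PQ.
have entersPQ i j : dynkin_edge D i j ->
    ((i \notin P) && (j \in P)) = ((i \notin Q) && (j \in Q)).
  move=> eij; have mem := schubert2_product_basis (complex R) rw_reduced _ eij.
  by apply: negb_inj; apply/idP/idP => /mem h; apply/mem; rewrite ?PQ // -PQ.
have boundaryPQ i j : dynkin_edge D i j ->
    [/\ (i \notin P) && (j \in P) = (i \notin Q) && (j \in Q)
      & (j \notin P) && (i \in P) = (j \notin Q) && (i \in Q)].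
  by move=> eij; split; apply: entersPQ; rewrite // dynkin_edge_sym.
(* If [P] and [Q] agreed at only one end of an edge, that edge would cross the boundary of exactly
   one of them. *)
have closed_agree : closed (dynkin_edge D) [pred k | (k \in P) == (k \in Q)].
  move=> i j /boundaryPQ[]; rewrite !inE.
  by case: (i \in P); case: (j \in P); case: (i \in Q); case: (j \in Q).
have neqPQ k : (k \in P) = ~~ (k \in Q).
  have [kPQ|] := eqVneq (k \in P) (k \in Q); last first.
    by case: (k \in P); case: (k \in Q).
  case: P_neq_Q; apply/setP => l; apply/eqP.
  have := closed_connect closed_agree (D_connected k l).
  by rewrite !inE kPQ eqxx => <-.
(* As [P] and [Q] are complementary, an edge entering [P] would leave [Q], against [boundaryPQ]. *)
have closedP : closed (dynkin_edge D) [pred k | k \in P].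
  move=> i j /boundaryPQ[]; move: (neqPQ i) (neqPQ j); rewrite !inE.
  by case: (i \in P); case: (j \in P); case: (i \in Q); case: (j \in Q).
apply: PQ_neq_GB.
(* By connectedness [P] is everything or empty, and [Q] is its complement: these are G and B in one
   order or the other. *)
have [[k kP]|noP] := pselect (exists k, k \in P).
  have PT : P = finset.setT.
    apply/setP => l; rewrite inE.
    by have := closed_connect closedP (D_connected k l); rewrite !inE kP.
  rewrite PT; congr [set _; _]%SET; apply/setP => l.
  by have := neqPQ l; rewrite PT !inE => /esym/negbTE.
have P0 : P = finset.set0.
  by apply/setP => l; rewrite inE; apply/negP => lP; apply: noP; exists l.
rewrite finset.setUC P0; congr [set _; _]%SET; apply/setP => l.
by have := neqPQ l; rewrite P0 !inE => /esym/negbFE.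
Qed.
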